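(* Let $k$ be a field of characteristic $p\neq 0$. There is a functor $p\text{-}\mathrm{preLie}\to p\text{-}\mathrm{Lie}$ sending a restricted pre-Lie algebra $(P,\{-,-\},(-)^{[p]})$ to $(P,[-,-],(-)^{[p]})$, where $[x,y]:=\{x,y\}-\{y,x\}$, and the following square of categories and functors is commutative: the composite $p\text{-}\mathrm{preLie}\to p\text{-}\mathrm{Lie}\to\mathrm{Lie}$ equals the composite $p\text{-}\mathrm{preLie}\to\mathrm{preLie}\to\mathrm{Lie}$, where $p\text{-}\mathrm{Lie}\to\mathrm{Lie}$ and $p\text{-}\mathrm{preLie}\to\mathrm{preLie}$ forget the $p$-map and $\mathrm{preLie}\to\mathrm{Lie}$ sends $(P,\{-,-\})$ to $(P,[-,-])$.
   Context: All algebras are over $k$; $\mathrm{Lie}$, $\mathrm{preLie}$, $p\text{-}\mathrm{Lie}$, $p\text{-}\mathrm{preLie}$ denote the categories of Lie, pre-Lie, restricted Lie and restricted pre-Lie algebras (in the restricted cases morphisms $f$ are required to satisfy $f(x^{[p]})=f(x)^{[p]}$). A restricted Lie algebra is a Lie algebra $L$ over $k$ with a map $(-)^{[p]}:L\to L$ such that for all $x,y\in L$, $\alpha\in k$: $(\alpha x)^{[p]}=\alpha^px^{[p]}$; $[x^{[p]},y]=[x,[x,\cdots[x,y]\cdots]]$ ($p$ copies of $x$); $(x+y)^{[p]}=x^{[p]}+y^{[p]}+\sum_{i=1}^{p-1}s_i(x,y)$, where $i\,s_i(x,y)$ is the coefficient of $\lambda^{i-1}$ in $[\lambda x+y,[\cdots,[\lambda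 x+y,x]\cdots]]$ with $p-1$ copies of $\lambda x+y$ ($\lambda$ a formal variable). A (left) pre-Lie algebra is a $k$-vector space $P$ with a bilinear operation $\{-,-\}:P\times P\to P$ such that $\{x,\{y,z\}\}-\{\{x,y\},z\}=\{y,\{x,z\}\}-\{\{y,x\},z\}$ for all $x,y,z\in P$. Then $[x,y]:=\{x,y\}-\{y,x\}$ is a Lie bracket on $P$. A restricted pre-Lie algebra is a pre-Lie algebra $(P,\{-,-\})$ over $k$ with a map $(-)^{[p]}:P\to P$ such that for all $x,y\in P$, $\alpha\in k$: (1) $(\alpha x)^{[p]}=\alpha^p x^{[p]}$; (2) $\{x^{[p]},y\}=\{x,\{x,\cdots\{x,y\}\cdots\}\}$ ($p$ copies of $x$); (3) $\{y,x^{[p]}\}=\{x,\{x,\cdots\{x,y\}\cdots\}\}-[x,[x,\cdots[x,y]\cdots]]$ ($p$ copies of $x$ in each term); (4) $(x+y)^{[p]}=x^{[p]}+y^{[p]}+\sum_{i=1}^{p-1}s_i(x,y)$, where $i\,s_i(x,y)$ is the coefficient of $\lambda^{i-1}$ in $[\lambda x+y,[\cdots,[\lambda x+y,x]\cdots]]$ with $p-1$ copies of $\lambda x+y$ ($\lambda$ a formal variable), for the bracket $[x,y]=\{x,y\}-\{y,x\}$. *)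

(* Defs.v *)
From HB Require Import structures.
From mathcomp Require Import all_boot all_order all_algebra.
From mathcomp Require Import boolp.

Set Implicit Arguments.
Unset Strict Implicit.
Unset Printing Implicit Defensive.

Import GRing.Theory.
Local Open Scope ring_scope.

Record category := Category {
  cat_ob :> Type;
  cat_hom : cat_ob -> cat_ob -> Type;
  cat_id : forall a, cat_hom a a;
  cat_comp : forall a b c, cat_hom b c -> cat_hom a b -> cat_hom a c;
  cat_comp_idl : forall a b (f : cat_hom a b), cat_comp (cat_id b) f = f;
  cat_comp_idr : forall a b (f : cat_hom a b), cat_comp f (cat_id a) = f;
  cat_compA : forall a b c d
    (h : cat_hom c d) (g : cat_hom b c) (f : cat_hom a b),
    cat_comp h (cat_comp g f) = cat_comp (cat_comp h g) f }.
Arguments cat_id {_} a.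
Arguments cat_comp {_ a b c} _ _.

Record functor (C D : category) := Functor {
  fob :> C -> D;
  fhom : forall a b : C, cat_hom a b -> cat_hom (fob a) (fob b);
  fhom_id : forall a : C, fhom (cat_id a) = cat_id (fob a);
  fhom_comp : forall (a b c : C) (g : cat_hom b c) (f : cat_hom a b),
    fhom (cat_comp g f) = cat_comp (fhom g) (fhom f) }.
Arguments fhom {C D} _ {a b} _.

Section FunctorComp.
Variables (C D E : category) (G : functor D E) (F : functor C D).

Lemma functor_comp_id a : fhom G (fhom F (cat_id a)) = cat_id (G (F a)).
Proof. by rewrite !fhom_id. Qed.

Lemma functor_comp_comp a b c (g : cat_hom b c) (f : cat_hom a b) :
  fhom G (fhom F (cat_comp g f)) =
    cat_comp (fhom G (fhom F g)) (fhom G (fhom F f)).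
Proof. by rewrite !fhom_comp. Qed.

Definition functor_comp : functor C E :=
  @Functor C E (fun a => G (F a)) (fun a b f => fhom G (fhom F f))
    functor_comp_id functor_comp_comp.

End FunctorComp.

(* The category of k-modules with extra structure [Ob], whose morphisms are   *)
(* the linear maps satisfying [P]. The two hypotheses make it a category.     *)
Section Concrete.
Variables (k : fieldType) (Ob : Type) (U : Ob -> lmodType k).
Variable P : forall A B : Ob, {linear U A -> U B} -> Prop.

Definition linear_id (V : lmodType k) : {linear V -> V} := idfun.
Definition linear_comp (V W X : lmodType k)
  (g : {linear W -> X}) (f : {linear V -> W}) : {linear V -> X} := g \o f.

Hypothesis P_id : forall A, P (linear_id (U A)).
Hypothesis P_comp : forall A B C (g : {linear U B -> U C})
  (f : {linear U A -> U B}), P g -> P f -> P (linear_comp g f).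

Record chom (A B : Ob) := CHom {
  chom_lin :> {linear U A -> U B};
  chomP : P chom_lin }.

Lemma linear_ext (V W : lmodType k) (f g : {linear V -> W}) : f =1 g -> f = g.
Proof.
move: f g => [f [[f1] [f2]]] [g [[g1] [g2]]] /= /funext fg.
by subst g; rewrite (Prop_irrelevance g1 f1) (Prop_irrelevance g2 f2).
Qed.

Lemma chom_ext A B (f g : chom A B) : f =1 g -> f = g.
Proof.
move: f g => [f Pf] [g Pg] /= /linear_ext fg.
by subst g; rewrite (Prop_irrelevance Pf Pg).
Qed.

Definition chom_id A : chom A A := CHom (P_id A).
Definition chom_comp A B C (g : chom B C) (f : chom A B) : chom A C :=
  CHom (P_comp (chomP g) (chomP f)).

Lemma chom_comp_idl A B (f : chom A B) : chom_comp (chom_id B) f = f.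
Proof. exact: chom_ext. Qed.
Lemma chom_comp_idr A B (f : chom A B) : chom_comp f (chom_id A) = f.
Proof. exact: chom_ext. Qed.
Lemma chom_compA A B C D (h : chom C D) (g : chom B C) (f : chom A B) :
  chom_comp h (chom_comp g f) = chom_comp (chom_comp h g) f.
Proof. exact: chom_ext. Qed.

Definition concrete_category : category :=
  @Category Ob chom chom_id chom_comp chom_comp_idl chom_comp_idr chom_compA.

End Concrete.

Section Algebras.
Variable k : fieldType.

Record is_lie (L : lmodType k) (br : L -> L -> L) : Prop := IsLie {
  lie_bilinear : bilinear_for *:%R *:%R br;
  lie_alternating : forall x, br x x = 0;
  lie_jacobi : forall x y z,
    br x (br y z) + br y (br z x) + br z (br x y) = 0 }.

Record lieAlg := LieAlg {
  lie_mod :> lmodType k;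
  lie_bracket : lie_mod -> lie_mod -> lie_mod;
  lieP : is_lie lie_bracket }.

Record is_preLie (P : lmodType k) (m : P -> P -> P) : Prop := IsPreLie {
  preLie_bilinear : bilinear_for *:%R *:%R m;
  preLie_assoc : forall x y z,
    m x (m y z) - m (m x y) z = m y (m x z) - m (m y x) z }.

Record preLieAlg := PreLieAlg {
  preLie_mod :> lmodType k;
  preLie_mul : preLie_mod -> preLie_mod -> preLie_mod;
  preLieP : is_preLie preLie_mul }.

Definition commutator (P : lmodType k) (m : P -> P -> P) (x y : P) : P :=
  m x y - m y x.

Lemma commutator_is_lie (P : preLieAlg) : is_lie (commutator (@preLie_mul P)).
Proof.
case: P => P m [[ml mr] ma] /=.
pose f y : {linear P -> P} :=
  HB.pack (m^~ y) (GRing.isLinear.Build k P P *:%R _ (ml y)).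
pose g y : {linear P -> P} :=
  HB.pack (m y) (GRing.isLinear.Build k P P *:%R _ (mr y)).
have mBl x y z : m (x - y) z = m x z - m y z := linearB (f z) x y.
have mBr x y z : m z (x - y) = m z x - m z y := linearB (g z) x y.
split; first split.
- move=> z a x y; rewrite /commutator /=; have /= -> := ml z a x y.
  by have /= -> := mr z a x y; rewrite scalerBr opprD addrACA.
- move=> z a x y; rewrite /commutator /=; have /= -> := ml z a x y.
  by have /= -> := mr z a x y; rewrite scalerBr opprD addrACA.
- by move=> x; rewrite /commutator subrr.
move=> x y z; rewrite /commutator !(mBl, mBr).
have e u v w : m (m u v) w - m (m v u) w = m u (m v w) - m v (m u w).
  rewrite -[m u (m v w)](subrK (m (m u v) w)) ma.
  by rewrite addrAC (addrAC (m v _)) subrr add0r addrC.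
rewrite !e !opprB !addrA !subrK.
rewrite (addrAC _ (- m y (m x z)) (m x (m z y))).
rewrite (addrAC _ (m z (m y x)) (m x (m z y))) subrK.
by rewrite (addrAC _ (- m y (m x z))) addrK subrK subrr.
Qed.

(* An element of V[X] is encoded by its coefficients: [f n] is that of X^n,   *)
(* so that [vmonom v n] is v X^n and [poly_bracket br] is the k[X]-bilinear   *)
(* extension of [br].                                                         *)
Definition vmonom (V : lmodType k) (v : V) (n : nat) : nat -> V :=
  fun m => if m == n then v else 0.

Definition poly_bracket (V : lmodType k) (br : V -> V -> V)
    (f g : nat -> V) : nat -> V :=
  fun n => \sum_(i < n.+1) br (f i) (g (n - i)%N).

(* In characteristic p, [i%:R] is invertible in k for 1 <= i < p, so          *)
(* [jacobson p br x y i] is the unique s_i(x,y) such that i s_i(x,y) is the   *)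
(* prescribed coefficient.                                                    *)
Definition jacobson (p : nat) (V : lmodType k) (br : V -> V -> V) (x y : V)
    (i : nat) : V :=
  i%:R^-1 *:
    iter p.-1 (poly_bracket br (vmonom x 1 \+ vmonom y 0)) (vmonom x 0) i.-1.

Variable p : nat.

Record is_restrictedLie (L : lieAlg) (pm : L -> L) : Prop := IsRestrictedLie {
  rLie_pmapZ : forall (a : k) x, pm (a *: x) = a ^+ p *: pm x;
  rLie_bracket : forall x y,
    lie_bracket (pm x) y = iter p (lie_bracket x) y;
  rLie_pmapD : forall x y, pm (x + y) =
    pm x + pm y + \sum_(1 <= i < p) jacobson p (@lie_bracket L) x y i }.

Record restrictedLie := RestrictedLie {
  rLie_lie :> lieAlg;
  rLie_pmap : rLie_lie -> rLie_lie;
  rLieP : is_restrictedLie rLie_pmap }.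

Record is_restrictedPreLie (P : preLieAlg) (pm : P -> P) : Prop :=
  IsRestrictedPreLie {
  rpreLie_pmapZ : forall (a : k) x, pm (a *: x) = a ^+ p *: pm x;
  rpreLie_mull : forall x y,
    preLie_mul (pm x) y = iter p (preLie_mul x) y;
  rpreLie_mulr : forall x y,
    preLie_mul y (pm x) = iter p (preLie_mul x) y
                          - iter p (commutator (@preLie_mul P) x) y;
  rpreLie_pmapD : forall x y, pm (x + y) =
    pm x + pm y
    + \sum_(1 <= i < p) jacobson p (commutator (@preLie_mul P)) x y i }.

Record restrictedPreLie := RestrictedPreLie {
  rpreLie_preLie :> preLieAlg;
  rpreLie_pmap : rpreLie_preLie -> rpreLie_preLie;
  rpreLieP : is_restrictedPreLie rpreLie_pmap }.

End Algebras.

Arguments lie_bracket {k l} _ _.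
Arguments preLie_mul {k p} _ _.
Arguments rLie_pmap {k p r} _.
Arguments rpreLie_pmap {k p r} _.

Section Categories.
Variable k : fieldType.

Definition lie_morph (L M : lieAlg k) (f : {linear L -> M}) : Prop :=
  forall x y, f (lie_bracket x y) = lie_bracket (f x) (f y).

Lemma lie_morph_id L : @lie_morph L L (linear_id L).
Proof. by []. Qed.
Lemma lie_morph_comp A B C (g : {linear lie_mod B -> lie_mod C})
  (f : {linear lie_mod A -> lie_mod B}) :
  lie_morph g -> lie_morph f -> lie_morph (linear_comp g f).
Proof. by move=> Hg Hf x y /=; rewrite Hf Hg. Qed.

Definition Lie : category := concrete_category lie_morph_id lie_morph_comp.

Definition preLie_morph (P Q : preLieAlg k) (f : {linear P -> Q}) : Prop :=
  forall x y, f (preLie_mul x y) = preLie_mul (f x) (f y).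

Lemma preLie_morph_id P : @preLie_morph P P (linear_id P).
Proof. by []. Qed.
Lemma preLie_morph_comp A B C (g : {linear preLie_mod B -> preLie_mod C})
  (f : {linear preLie_mod A -> preLie_mod B}) :
  preLie_morph g -> preLie_morph f -> preLie_morph (linear_comp g f).
Proof. by move=> Hg Hf x y /=; rewrite Hf Hg. Qed.

Definition preLie : category :=
  concrete_category preLie_morph_id preLie_morph_comp.

Variable p : nat.

Definition rLie_morph (L M : restrictedLie k p) (f : {linear L -> M}) : Prop :=
  lie_morph f /\ forall x, f (rLie_pmap x) = rLie_pmap (f x).

Lemma rLie_morph_id L : @rLie_morph L L (linear_id L).
Proof. by []. Qed.
Lemma rLie_morph_comp (A B C : restrictedLie k p)
  (g : {linear B -> C}) (f : {linear A -> B}) :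
  rLie_morph g -> rLie_morph f -> rLie_morph (linear_comp g f).
Proof.
move=> [Hg gp] [Hf fp]; split; first exact: lie_morph_comp.
by move=> x /=; rewrite fp gp.
Qed.

Definition pLie : category := concrete_category rLie_morph_id rLie_morph_comp.

Definition rpreLie_morph (P Q : restrictedPreLie k p) (f : {linear P -> Q}) :
    Prop :=
  preLie_morph f /\ forall x, f (rpreLie_pmap x) = rpreLie_pmap (f x).

Lemma rpreLie_morph_id P : @rpreLie_morph P P (linear_id P).
Proof. by []. Qed.
Lemma rpreLie_morph_comp (A B C : restrictedPreLie k p)
  (g : {linear B -> C}) (f : {linear A -> B}) :
  rpreLie_morph g -> rpreLie_morph f -> rpreLie_morph (linear_comp g f).
Proof.
move=> [Hg gp] [Hf fp]; split; first exact: preLie_morph_comp.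
by move=> x /=; rewrite fp gp.
Qed.

Definition ppreLie : category :=
  concrete_category rpreLie_morph_id rpreLie_morph_comp.

Definition pLie_forget_hom (L M : pLie) (f : cat_hom L M) :
    @cat_hom Lie (rLie_lie L) (rLie_lie M) :=
  CHom (P := lie_morph) (chomP f).1.

Definition pLie_forget : functor pLie Lie.
Proof.
by apply: (@Functor pLie Lie (@rLie_lie k p) pLie_forget_hom) => *;
   apply: chom_ext.
Defined.

Definition ppreLie_forget_hom (P Q : ppreLie) (f : cat_hom P Q) :
    @cat_hom preLie (rpreLie_preLie P) (rpreLie_preLie Q) :=
  CHom (P := preLie_morph) (chomP f).1.

Definition ppreLie_forget : functor ppreLie preLie.
Proof.
by apply: (@Functor ppreLie preLie (@rpreLie_preLie k p) ppreLie_forget_hom)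
  => *; apply: chom_ext.
Defined.

Definition lie_of_preLie (P : preLieAlg k) : lieAlg k :=
  LieAlg (commutator_is_lie P).

Lemma preLie_morph_lie (P Q : preLieAlg k) (f : {linear P -> Q}) :
  preLie_morph f -> @lie_morph (lie_of_preLie P) (lie_of_preLie Q) f.
Proof. by move=> Hf x y; rewrite /= /commutator linearB !Hf. Qed.

Definition preLie_to_Lie_hom (P Q : preLie) (f : cat_hom P Q) :
    @cat_hom Lie (lie_of_preLie P) (lie_of_preLie Q) :=
  CHom (P := lie_morph) (preLie_morph_lie (chomP f)).

Definition preLie_to_Lie : functor preLie Lie.
Proof.
by apply: (@Functor preLie Lie lie_of_preLie preLie_to_Lie_hom) => *;
   apply: chom_ext.
Defined.

End Categories.

(* Main.v *)
Require Import Defs.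
From mathcomp Require Import all_boot all_order all_algebra.
From mathcomp Require Import boolp.

Set Implicit Arguments.
Unset Strict Implicit.
Unset Printing Implicit Defensive.

Import GRing.Theory.
Local Open Scope ring_scope.

(** In a restricted pre-Lie algebra, left multiplication by the p-th power of x
is the p-th iterate of left multiplication by x, and right multiplication by it
is that same iterate minus the p-th iterate of the bracket with x. The bracket
with the p-th power of x is the difference of the two, in which the iterated
products cancel and the iterated bracket remains: this is the restricted Lie
axiom relating the bracket to the p-map. The other two axioms, on scalar
multiples and on sums, see the product only through the bracket and are the same
in both structures. This is [commutator_is_restrictedLie].

The functor keeps the underlying linear map of each morphism. Both composites in
the square therefore send an algebra to the same Lie algebra, by computation,
and a morphism to the same linear map. What may differ is the proof that this
map respects the bracket, together with the proofs of functoriality, and such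
proofs are irrelevant ([chom_ext], [functor_ext]). *)

(** The object map is shared by the two functors, so that their morphism maps
have the same type and can be compared without transport along an equality of
objects. *)
Lemma functor_ext (C D : category) (ob : C -> D)
    (h1 h2 : forall a b : C, cat_hom a b -> cat_hom (ob a) (ob b)) id1 comp1
    id2 comp2 :
    (forall a b (f : cat_hom a b), h1 a b f = h2 a b f) ->
  @Functor C D ob h1 id1 comp1 = @Functor C D ob h2 id2 comp2.
Proof.
move=> h12.
have {}h12 : h1 = h2.
  by apply: functional_extensionality_dep => a;
     apply: functional_extensionality_dep => b; apply: funext => f.
by subst h2; rewrite (Prop_irrelevance id1 id2) (Prop_irrelevance comp1 comp2).
Qed.

Section RestrictedLieOfPreLie.
Variables (k : fieldType) (p : nat).

Lemma commutator_is_restrictedLie (P : preLieAlg k) (pm : P -> P) :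
  is_restrictedPreLie p pm -> is_restrictedLie p (L := lie_of_preLie P) pm.
Proof.
case=> pmZ mull mulr pmD; split=> // x y.
by rewrite /= /commutator mull mulr subKr.
Qed.

Definition restrictedLie_of_preLie (P : restrictedPreLie k p) :
    restrictedLie k p :=
  RestrictedLie (commutator_is_restrictedLie (rpreLieP P)).

Lemma rpreLie_morph_lie (P Q : restrictedPreLie k p) (f : {linear P -> Q}) :
  rpreLie_morph f ->
  @rLie_morph k p (restrictedLie_of_preLie P) (restrictedLie_of_preLie Q) f.
Proof. by case=> fM fp; split=> //; apply: preLie_morph_lie. Qed.

Definition ppreLie_to_pLie_hom (P Q : ppreLie k p) (f : cat_hom P Q) :
    @cat_hom (pLie k p) (restrictedLie_of_preLie P)
      (restrictedLie_of_preLie Q) :=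
  CHom (P := @rLie_morph k p) (rpreLie_morph_lie (chomP f)).

Definition ppreLie_to_pLie : functor (ppreLie k p) (pLie k p).
Proof.
by apply: (@Functor (ppreLie k p) (pLie k p) restrictedLie_of_preLie
  ppreLie_to_pLie_hom) => *; apply: chom_ext.
Defined.

Lemma ppreLie_to_pLie_square :
  functor_comp (pLie_forget k p) ppreLie_to_pLie =
    functor_comp (preLie_to_Lie k) (ppreLie_forget k p).
Proof. by apply: functor_ext => P Q f; apply: chom_ext. Qed.

End RestrictedLieOfPreLie.

Theorem proposition2p4 (k : fieldType) (p : nat) (charp : p \in [pchar k]) :
  exists (H : forall P : restrictedPreLie k p,
                is_restrictedLie p (L := lie_of_preLie P) (@rpreLie_pmap k p P))
         (F : functor (ppreLie k p) (pLie k p)),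
    (forall P : restrictedPreLie k p, F P = RestrictedLie (H P)) /\
    functor_comp (pLie_forget k p) F =
      functor_comp (preLie_to_Lie k) (ppreLie_forget k p).
Proof.
exists (fun P => commutator_is_restrictedLie (rpreLieP P)).
by exists (ppreLie_to_pLie k p); split; last exact: ppreLie_to_pLie_square.
Qed.
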